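(* Let $G$ be the free group of finite rank $m\ge1$ with fixed free basis $\{a_1,\dots,a_m\}$. For any integer $l>0$, the set $S_l$ of endomorphisms of $G$ satisfies $D(S_l)=1$.
   Context: Elements of $G$ are identified with reduced words in the letters $a_i^{\pm1}$. An endomorphism $\phi:G\to G$ has remnant when, for each $i$, there is a nontrivial subword of (the reduced word) $\phi(a_i)$ which does not cancel in any product of the form $\phi(a_j)^{\pm1}\phi(a_i)\phi(a_k)^{\pm1}$, except for when $j$ or $k$ equals $i$ and the corresponding exponent is $-1$. The maximal such noncanceling subword of $\phi(a_i)$ is denoted $\mathrm{Rem}_\phi a_i$. For a generator $a_i$ and a reduced word $w$, $\Phi_{a_i}(w)$ is the number of times that $a_i$ or $a_i^{-1}$ appears in $w$. $S_l$ is the set of endomorphisms $\phi$ of $G$ (having remnant) such that $\Phi_{a_i}(\mathrm{Rem}_\phi a_j)\ge l$ for all generators $a_i,a_j$. Asymptotic density: let $G_p$ be the set of elements of $G$ of reduced word length at most $p$. Identify an endomorphism $\phi$ of $G$ with the $m$-tuple $(\phi(a_1),\dots,\phi(a_m))\in G^m$. For a set $S\subset G^m$ of endomorphisms, $D(S)=\lim_{p\to\infty}\frac{|S\cap (G_p)^m|}{|(G_p)^m|}$. *)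

(* Defs.v *)
From HB Require Import structures.
From mathcomp Require Import all_boot all_order all_algebra.
From mathcomp Require Import finmap.
From mathcomp Require Import all_classical all_reals all_analysis.
Set Implicit Arguments.
Unset Strict Implicit.
Unset Printing Implicit Defensive.

Import Order.TTheory GRing.Theory Num.Theory.
Import numFieldNormedType.Exports.
Local Open Scope classical_set_scope.

(* [(i, true)] stands for $a_i$ and [(i, false)] for $a_i^{-1}$. *)
Definition letter (m : nat) := ('I_m * bool)%type.

Definition linv {m} (x : letter m) : letter m := (x.1, ~~ x.2).

Definition reduced {m} (w : seq (letter m)) : bool :=
  sorted (fun x y => y != linv x) w.

Definition push {m} (x : letter m) (w : seq (letter m)) :=
  if w is y :: w' then if y == linv x then w' else x :: w else [:: x].

Definition reduce {m} (w : seq (letter m)) : seq (letter m) :=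
  foldr push [::] w.

Lemma linvK {m} : involutive (@linv m).
Proof. by case=> i b; rewrite /linv /= negbK. Qed.

Lemma push_reduced {m} (x : letter m) w : reduced w -> reduced (push x w).
Proof.
case: w => //= y w; case: eqP => [_ | /eqP neq]; first exact: path_sorted.
by rewrite /= neq.
Qed.

Lemma pushK {m} (x : letter m) w : reduced w -> push (linv x) (push x w) = w.
Proof.
case: w => [|y w] /=; first by rewrite linvK eqxx.
case: eqP => [-> | _] /=; last by rewrite linvK eqxx.
by case: w => //= z w /andP[/negPf->].
Qed.

Lemma foldr_push_reduced {m} (u w : seq (letter m)) :
  reduced w -> reduced (foldr push w u).
Proof. by move=> rw; elim: u => //= x u; apply: push_reduced. Qed.

Lemma reduce_reduced {m} (w : seq (letter m)) : reduced (reduce w).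
Proof. exact: foldr_push_reduced. Qed.

Lemma reduce_id {m} (w : seq (letter m)) : reduced w -> reduce w = w.
Proof.
elim: w => //= x w IHw rw; rewrite IHw; last exact: path_sorted rw.
by case: w rw {IHw} => //= y w /andP[/negPf->].
Qed.

Lemma foldr_push_reduce {m} (u w : seq (letter m)) :
  reduced w -> foldr push w (reduce u) = foldr push w u.
Proof.
move=> rw; elim: u => //= x u <-.
case: (reduce u) => //= y v; case: eqP => //= ->.
by have := pushK (linv x) (foldr_push_reduced v rw); rewrite linvK.
Qed.

Lemma reduce_catl {m} (u v : seq (letter m)) :
  reduce (reduce u ++ v) = reduce (u ++ v).
Proof. by rewrite /reduce !foldr_cat foldr_push_reduce // reduce_reduced. Qed.

Lemma reduce_catr {m} (u v : seq (letter m)) :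
  reduce (u ++ reduce v) = reduce (u ++ v).
Proof. by rewrite /reduce !foldr_cat; congr foldr; apply/reduce_id/reduce_reduced. Qed.

Record freegrp (m : nat) := FreeGrp {
  fword :> seq (letter m);
  _ : reduced fword
}.

HB.instance Definition _ m := [isSub for @fword m].
HB.instance Definition _ m := [Choice of freegrp m by <:].

Definition of_word {m} (w : seq (letter m)) : freegrp m :=
  FreeGrp (reduce_reduced w).

Definition winv {m} (w : seq (letter m)) := rev (map linv w).

Definition fmul {m} (u v : freegrp m) : freegrp m := of_word (u ++ v).
Definition fone {m} : freegrp m := of_word [::].
Definition finv {m} (u : freegrp m) : freegrp m := of_word (winv u).

Lemma winvK {m} : involutive (@winv m).
Proof.
by move=> w; rewrite /winv map_rev revK -map_comp (eq_map linvK) map_id.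
Qed.

Lemma reduce_winv {m} (w : seq (letter m)) : reduce (winv w ++ w) = [::].
Proof.
elim: w => //= x w IHw.
rewrite /winv /= rev_cons cat_rcons -reduce_catr /=.
by rewrite pushK ?reduce_reduced // reduce_catr.
Qed.

Fact fmulA {m} : associative (@fmul m).
Proof.
by move=> u v w; apply: val_inj; rewrite /= reduce_catr reduce_catl catA.
Qed.

Fact fmul1 {m} : left_id (@fone m) fmul.
Proof. by case=> u ru; apply: val_inj; rewrite /= reduce_id. Qed.

Fact fmulr1 {m} : right_id (@fone m) fmul.
Proof. by case=> u ru; apply: val_inj; rewrite /= cats0 reduce_id. Qed.

Fact fmulV {m} : left_inverse (@fone m) finv fmul.
Proof.
by move=> u; apply: val_inj; rewrite /= reduce_catl reduce_winv.
Qed.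

Fact fmulrV {m} : right_inverse (@fone m) finv fmul.
Proof.
move=> u; apply: val_inj; rewrite /= reduce_catr.
by rewrite -{1}(winvK u) reduce_winv.
Qed.

HB.instance Definition _ m :=
  isGroup.Build (freegrp m) fmulA fmul1 fmulr1 fmulV fmulrV.

Definition gen {m} (i : 'I_m) : freegrp m := of_word [:: (i, true)].

(* [gsgn g true] is $g$ and [gsgn g false] is $g^{-1}$. *)
Definition gsgn {m} (g : freegrp m) (e : bool) : freegrp m :=
  if e then g else (g^-1)%g.

Definition endo (m : nat) := {multiplicative freegrp m -> freegrp m}.

(* A subword of the reduced word of [phi (gen i)] is an occurrence
   [x ++ r ++ y] of a factor [r].  It does not cancel in a product
   $u\,\phi(a_i)\,v$ when the reduced form of that product still displays [r],
   all cancellation taking place within $u x$ on the left of [r] and within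
   $y v$ on its right. *)
Definition noncanceling {m} (phi : endo m) (i : 'I_m)
    (x r y : seq (letter m)) : Prop :=
  [/\ fword (phi (gen i)) = x ++ r ++ y, r <> [::]
    & forall (j k : 'I_m) (e f : bool),
        (j, e) <> (i, false) -> (k, f) <> (i, false) ->
        let u := gsgn (phi (gen j)) e in
        let v := gsgn (phi (gen k)) f in
        fword (u * phi (gen i) * v)%g
        = fword (u * of_word x)%g ++ r ++ fword (of_word y * v)%g].

Definition has_remnant {m} (phi : endo m) : Prop :=
  forall i : 'I_m, exists x r y, noncanceling phi i x r y.

(* [r] is the largest noncanceling subword: as an occurrence in the word of
   [phi (gen i)], it contains every noncanceling one. *)
Definition is_remnant {m} (phi : endo m) (i : 'I_m) (r : seq (letter m)) :
    Prop :=
  exists x y, noncanceling phi i x r y /\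
    forall x' r' y', noncanceling phi i x' r' y' ->
      (size x <= size x')%N /\ (size y <= size y')%N.

(* The value is the empty word when there is no noncanceling subword. *)
Definition Rem {m} (phi : endo m) (i : 'I_m) : seq (letter m) :=
  xget [::] [set r | is_remnant phi i r].

(* Occurrences of $a_i$ and $a_i^{-1}$ together. *)
Definition occurrences {m} (i : 'I_m) (w : seq (letter m)) : nat :=
  count (fun x => x.1 == i) w.

Definition S_ {m} (l : nat) : set (endo m) :=
  [set phi | has_remnant phi /\
     forall i j : 'I_m, (l <= occurrences i (Rem phi j))%N].

(* By freeness, an endomorphism amounts to the tuple of the images of the
   generators, an arbitrary element of $G^m$. *)
Definition images {m} (phi : endo m) : {ffun 'I_m -> freegrp m} :=
  [ffun i => phi (gen i)].

Definition ball_tuples (m p : nat) : set {ffun 'I_m -> freegrp m} :=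
  [set t | forall i, (size (fword (t i)) <= p)%N].
Arguments ball_tuples : clear implicits.

(* [fset_set], used below to count, is meaningful only on finite sets. *)
Lemma finite_ball_tuples m p : finite_set (ball_tuples m p).
Proof.
pose T := p.-bseq (letter m).
pose F (s : {ffun 'I_m -> T}) : {ffun 'I_m -> freegrp m} :=
  [ffun i => of_word (s i)].
apply: (@sub_finite_set _ _ (F @` setT)); last first.
  exact: finite_image (@finite_finset {ffun 'I_m -> T} _).
move=> t tp; exists [ffun i => insub_bseq p (fword (t i))] => //.
apply/ffunP => i; rewrite !ffunE; apply: val_inj => /=.
by rewrite insubdK; [apply: reduce_id; apply: (valP (t i)) | exact: tp].
Qed.

Definition density_ratio (R : realType) {m} (S : set (endo m)) (p : nat) : R :=
  (#|` fset_set (images @` S `&` ball_tuples m p)|%:R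
   / #|` fset_set (ball_tuples m p)|%:R)%R.

(* $D(S) = d$, including the existence of the limit. *)
Definition has_density (R : realType) {m} (S : set (endo m)) (d : R) : Prop :=
  density_ratio R S @ \oo --> d.

(* Main.v *)
Require Import Defs.
From HB Require Import structures.
From mathcomp Require Import all_boot all_order all_algebra.
From mathcomp Require Import finmap zify.
From mathcomp Require Import all_classical all_reals all_analysis.

(* Fix [k]. If the prefixes of length [k] of the words [phi(a_i)^{+-1}] are
   pairwise distinct, every cancellation in [phi(a_j)^{+-1} phi(a_i)
   phi(a_k)^{+-1}] stops before the [k]-th letter, so what remains of [phi(a_i)]
   without its first and last [k] letters does not cancel. It contains each
   generator at least [l] times as soon as [phi(a_i)] does at least [l + 2k]
   times. Both conditions fail rarely. A word with few letters [a_i^{+-1}] has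
   many extensions by one more such letter, and each extension comes from few
   words. A tuple with two equal prefixes is determined by what is left after
   removing one of them, and for [m > 1] shortening a word by [k] letters
   divides the size of the ball by at least [2^k]; for [m = 1] no prefixes
   coincide. *)

Set Implicit Arguments.
Unset Strict Implicit.
Unset Printing Implicit Defensive.

Import Order.TTheory GRing.Theory Num.Theory.
Import numFieldNormedType.Exports.

Local Open Scope nat_scope.

(** * Cancellation in products of reduced words *)

(** Being reduced only concerns adjacent letters, and as [r] is nonempty each adjacent pair lies in
    [u ++ r] or in [r ++ v]. *)
Lemma reduced_cat_overlap m (u r v : seq (letter m)) :
  r <> [::] -> reduced (u ++ r) -> reduced (r ++ v) -> reduced (u ++ r ++ v).
Proof.
case: r => // b r _; case: u => //= a u.
rewrite /reduced /= !cat_path /= => /andP[-> /andP[-> _]].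
by rewrite cat_path => ->.
Qed.

Lemma reduced_catl m (u v : seq (letter m)) : reduced (u ++ v) -> reduced u.
Proof. by case/cat_sorted2. Qed.

Lemma reduced_catr m (u v : seq (letter m)) : reduced (u ++ v) -> reduced v.
Proof. by case/cat_sorted2. Qed.

Lemma reduced_winv m (w : seq (letter m)) : reduced (winv w) = reduced w.
Proof.
rewrite /reduced /winv rev_sorted sorted_map; apply: eq_sorted => x y /=.
by rewrite linvK eq_sym.
Qed.

Lemma winv_cat m (u v : seq (letter m)) : winv (u ++ v) = winv v ++ winv u.
Proof. by rewrite /winv map_cat rev_cat. Qed.

Lemma size_winv m (w : seq (letter m)) : size (winv w) = size w.
Proof. by rewrite size_rev size_map. Qed.

(** A letter put in front of [u] can meet the reduced product only if all of [u] has been cancelled;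
    then it may lengthen [c] by one letter. *)
Lemma reduce_cat_cancel m (u v : seq (letter m)) :
  reduced u -> reduced v -> exists c u' v',
    [/\ u = u' ++ winv c, v = c ++ v' & reduce (u ++ v) = u' ++ v'].
Proof.
move=> + rv; elim: u => [|x u IHu] ru.
  by exists [::], [::], v; split => //=; exact: reduce_id.
have [c [u' [v' [eu ev euv]]]] := IHu (path_sorted ru).
rewrite /= -/(reduce (u ++ v)) euv; case: u' eu euv => [|y u'] eu euv /=.
- case: v' ev euv => [|y v'] ev euv /=.
    by exists c, [:: x], [::]; rewrite eu.
  case: eqP => [eyx|_]; last by exists c, [:: x], (y :: v'); rewrite eu.
  exists (rcons c y), [::], v'; split => //; last by rewrite cat_rcons.
  by rewrite eu eyx -cats1 winv_cat /winv /= linvK.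
- exists c, (x :: y :: u'), v'; rewrite eu; split => //=.
  by move: ru; rewrite eu /reduced /= => /andP[/negPf->].
Qed.

(** If all of [x] were cancelled, the inverse of [u] would begin with [x]. So a last part of [x]
    survives and still shields [r]. *)
Lemma reduced_cancel_left m k (u x r : seq (letter m)) :
  reduced u -> reduced (x ++ r) -> size x = k -> take k (winv u) != x ->
  reduced (reduce (u ++ x) ++ r).
Proof.
move=> ru rxr sx nux.
have [c [u' [x' [eu ex eux]]]] := reduce_cat_cancel ru (reduced_catl rxr).
rewrite eux -catA; case: x' ex eux => [|y x'] ex eux.
  rewrite cats0 in ex; move: nux.
  by rewrite eu winv_cat winvK ex take_size_cat ?eqxx // -ex.
apply: (@reduced_cat_overlap _ u' (y :: x')) => //.
  by rewrite -eux reduce_reduced.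
by apply: (@reduced_catr _ c); rewrite catA -ex.
Qed.

Lemma reduced_cancel_right m k (r y v : seq (letter m)) :
  reduced v -> reduced (r ++ y) -> size y = k -> take k v != winv y ->
  reduced (r ++ reduce (y ++ v)).
Proof.
move=> rv rry sy nvy.
have [c [y' [v' [ey ev eyv]]]] := reduce_cat_cancel (reduced_catr rry) rv.
rewrite eyv; case/lastP: y' ey eyv => [|y' z] ey eyv.
  by move: nvy; rewrite ev ey /= winvK take_size_cat ?eqxx // -sy ey size_winv.
have nz : rcons y' z <> [::] by case: (y').
apply: reduced_cat_overlap => //; last by rewrite -eyv reduce_reduced.
by apply: (@reduced_catl _ _ (winv c)); rewrite -catA -ey.
Qed.

Lemma fwordM m (u v : freegrp m) : fword (u * v)%g = reduce (fword u ++ fword v).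
Proof. by []. Qed.

Lemma fword_reduced m (u : freegrp m) : reduced (fword u).
Proof. exact: (valP u). Qed.

Definition wsgn m (w : seq (letter m)) (e : bool) := if e then w else winv w.

Lemma fword_gsgn m (u : freegrp m) e : fword (gsgn u e) = wsgn (fword u) e.
Proof.
by case: e => //=; apply: reduce_id; rewrite reduced_winv fword_reduced.
Qed.

Lemma wsgnN m (w : seq (letter m)) e : wsgn w (~~ e) = winv (wsgn w e).
Proof. by case: e => //=; rewrite winvK. Qed.

Lemma reduced_wsgn m (w : seq (letter m)) e : reduced (wsgn w e) = reduced w.
Proof. by case: e => //=; rewrite reduced_winv. Qed.

Lemma size_wsgn m (w : seq (letter m)) e : size (wsgn w e) = size w.
Proof. by case: e => //=; rewrite size_winv. Qed.

Lemma wsgn_inj m e : injective (fun w : seq (letter m) => wsgn w e).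
Proof. by case: e => // u v /(can_inj winvK). Qed.

(** * Noncanceling subwords and the remnant *)

Definition stops_left m (phi : endo m) i (x r : seq (letter m)) :=
  forall j e, (j, e) <> (i, false) ->
    reduced (reduce (fword (gsgn (phi (gen j)) e) ++ x) ++ r).

Definition stops_right m (phi : endo m) i (r y : seq (letter m)) :=
  forall k f, (k, f) <> (i, false) ->
    reduced (r ++ reduce (y ++ fword (gsgn (phi (gen k)) f))).

(* The conditions on the two ends of the subword decouple, which is what makes
   a largest noncanceling subword exist. *)
Lemma noncancelingP m (phi : endo m) i x r y :
  noncanceling phi i x r y <->
  [/\ fword (phi (gen i)) = x ++ r ++ y, r <> [::],
      stops_left phi i x (r ++ y) & stops_right phi i (x ++ r) y].
Proof.
split=> [[ew r0 H]|[ew r0 Hl Hr]]; split=> //.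
(* Any admissible right factor serves to isolate the left condition; [phi (gen i)] itself always is
   one. *)
- move=> j e je; have E := H j i e true je ltac:(by []); move: E => /=.
  rewrite reduce_catr => /(congr1 reduced); rewrite reduce_reduced => /esym.
  rewrite catA => /reduced_catl redl; apply: reduced_cat_overlap => //.
  by apply: (@reduced_catr _ x); rewrite -ew fword_reduced.
- move=> k f kf; have E := H i k true f ltac:(by []) kf; move: E => /=.
  rewrite !reduce_catl => /(congr1 reduced); rewrite !reduce_reduced => /esym.
  move=> /reduced_catr redr; rewrite -catA; apply: reduced_cat_overlap => //.
  by apply: (@reduced_catl _ _ y); rewrite -catA -ew fword_reduced.
- move=> j k e f je kf /=.
  rewrite !reduce_catl reduce_catr ew -[RHS]reduce_id; last first.
    apply: reduced_cat_overlap => //.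
      by have := Hl j e je; rewrite catA => /reduced_catl.
    by have := Hr k f kf; rewrite -catA => /reduced_catr.
  by rewrite reduce_catl !catA reduce_catr !catA.
Qed.

Lemma size_remnant_complement m (phi : endo m) i x r y :
  noncanceling phi i x r y -> size x + size y < size (fword (phi (gen i))).
Proof. by case=> -> + _; case: r => // a r _; rewrite !size_cat /=; lia. Qed.

(** The left condition depends only on the length [a] removed on the left, the right one only on
    [b], so both are minimized independently. One known noncanceling subword bounds [a + b], which
    leaves a nonempty middle. *)
Lemma remnant_exists m (phi : endo m) i x0 r0 y0 :
  noncanceling phi i x0 r0 y0 -> exists r, is_remnant phi i r.
Proof.
move=> nc0; have /noncancelingP[ew0 _ Hl0 Hr0] := nc0.
set w := fword (phi (gen i)) in ew0 *.
pose P a := `[< stops_left phi i (take a w) (drop a w) >].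
pose Q b := `[< stops_right phi i (take (size w - b) w) (drop (size w - b) w) >].
have PX x r y : noncanceling phi i x r y -> P (size x).
  case/noncancelingP => ew _ Hl _; apply/asboolP.
  by rewrite /w ew take_size_cat // drop_size_cat.
have QX x r y : noncanceling phi i x r y -> Q (size y).
  case/noncancelingP => ew _ _ Hr; apply/asboolP.
  by rewrite /w ew catA size_cat addnK take_size_cat // drop_size_cat.
case: (ex_minnP (ex_intro P _ (PX _ _ _ nc0))) => a /asboolP Pa mina.
case: (ex_minnP (ex_intro Q _ (QX _ _ _ nc0))) => b /asboolP Qb minb.
have lt_ab : a + b < size w.
  apply: leq_ltn_trans (size_remnant_complement nc0).
  by rewrite leq_add ?mina ?minb //; [apply: PX nc0|apply: QX nc0].
have ed : drop a w = take (size w - b - a) (drop a w) ++ drop (size w - b) w.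
  rewrite -{1}(cat_take_drop (size w - b - a) (drop a w)).
  by rewrite drop_drop subnK //; lia.
exists (take (size w - b - a) (drop a w)), (take a w), (drop (size w - b) w).
split.
  apply/noncancelingP; split; rewrite -?ed ?cat_take_drop //.
    by move/(congr1 size); rewrite size_take size_drop /=; case: ltnP; lia.
  rewrite (_ : take a w ++ _ = take (size w - b) w) //.
  by rewrite -takeD; congr take; lia.
move=> x' r' y' nc'; rewrite size_takel ?size_drop; last lia.
rewrite subKn; last lia.
by split; [apply: mina; apply: PX nc'|apply: minb; apply: QX nc'].
Qed.

(** Maximality makes [x] a prefix of [x0] and [y] a suffix of [y0], so [r0] is a factor of [r]. *)
Lemma remnant_occurrences m (phi : endo m) i j r x0 r0 y0 :
  is_remnant phi i r -> noncanceling phi i x0 r0 y0 ->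
  occurrences j r0 <= occurrences j r.
Proof.
case=> x [y [[ew _ _] max]] nc0; have [lex ley] := max _ _ _ nc0.
case: nc0 => ew0 _ _; rewrite ew in ew0.
have ex : x0 = x ++ drop (size x) x0.
  rewrite -{1}(cat_take_drop (size x) x0); congr (_ ++ _).
  by have := congr1 (take (size x)) ew0; rewrite take_size_cat // takel_cat.
have ey : y0 = take (size y0 - size y) y0 ++ y.
  rewrite -{1}(cat_take_drop (size y0 - size y) y0); congr (_ ++ _).
  have := congr1 (drop (size (x ++ r))) ew0.
  rewrite catA drop_size_cat // catA drop_cat.
  have := congr1 size ew0; rewrite !size_cat => es.
  rewrite ltnNge (_ : size x0 + size r0 <= size x + size r) /=; last lia.
  by move=> e; rewrite [RHS]e; congr drop; lia.
have er : size r = size ((drop (size x) x0 ++ r0) ++ take (size y0 - size y) y0).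
  move: lex ley (congr1 size ew0).
  rewrite !size_cat size_drop size_takel ?leq_subr //; lia.
move: ew0; rewrite {1}ex {1}ey -!catA => /eqP; rewrite eqseq_cat // eqxx /=.
rewrite !catA eqseq_cat // => /andP[/eqP -> _].
by rewrite /occurrences !count_cat; lia.
Qed.

Lemma occurrences_Rem m (phi : endo m) i j x r y :
  noncanceling phi i x r y -> occurrences j r <= occurrences j (Rem phi i).
Proof.
move=> nc; apply: (remnant_occurrences j _ nc).
exact: (xgetPex [::] (remnant_exists nc)).
Qed.

(** The sign [f] selects the end of [w]: [true] compares its first [k] letters with inverses of left
    factors, [false] the inverse of its last [k] letters with right factors. *)
Lemma noncanceling_middle m (phi : endo m) i k w :
  fword (phi (gen i)) = w -> 2 * k < size w ->
  (forall j e f, (j, e) <> (i, f) ->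
     take k (wsgn (fword (phi (gen j))) e) != take k (wsgn w f)) ->
  noncanceling phi i (take k w) (take (size w - k - k) (drop k w))
    (drop (size w - k) w).
Proof.
move=> ew ltkw Hdiff.
have ed : drop k w = take (size w - k - k) (drop k w) ++ drop (size w - k) w.
  rewrite -{1}(cat_take_drop (size w - k - k) (drop k w)).
  by rewrite drop_drop subnK //; lia.
have et : take k w ++ take (size w - k - k) (drop k w) = take (size w - k) w.
  by rewrite -takeD; congr take; lia.
have rw : reduced w by rewrite -ew fword_reduced.
apply/noncancelingP; split; rewrite -?ed ?et ?cat_take_drop //.
- by move/(congr1 size); rewrite size_take size_drop /=; case: ltnP; lia.
- move=> j e je; apply: (@reduced_cancel_left _ k); rewrite ?fword_reduced //.
  + by rewrite cat_take_drop.
  + by rewrite size_takel //; lia.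
  + rewrite fword_gsgn -wsgnN; apply: (Hdiff j (~~ e) true).
    by case=> ej /negbRL /= ee; apply: je; rewrite ej ee.
- move=> j e je; apply: (@reduced_cancel_right _ k); rewrite ?fword_reduced //.
  + by rewrite cat_take_drop.
  + by rewrite size_drop; lia.
  + rewrite fword_gsgn; have := Hdiff j e false je => /=.
    rewrite -{1}(cat_take_drop (size w - k) w) winv_cat take_size_cat //.
    by rewrite size_winv size_drop; lia.
Qed.

(** * Endomorphisms from tuples, and a sufficient condition for [S_ l] *)

Definition extend m (t : {ffun 'I_m -> freegrp m}) (w : freegrp m) : freegrp m :=
  foldr (fun x g => gsgn (t x.1) x.2 * g)%g 1%g (fword w).

(** A cancelling pair of letters contributes $g g^{-1}$, so the product of the images is unchanged
    by [push], hence by [reduce]. *)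
Lemma extend_multiplicative m (t : {ffun 'I_m -> freegrp m}) :
  {morph extend t : u v / (u * v)%g}.
Proof.
pose F := foldr (fun x g => gsgn (t x.1) x.2 * g)%g 1%g.
have Fpush x w : F (push x w) = (gsgn (t x.1) x.2 * F w)%g.
  case: w => [|y w] //=; case: eqP => [->|//] /=.
  by rewrite mulgA; case: x.2 => /=; rewrite ?mulgV ?mulVg mul1g.
have Fred w : F (reduce w) = F w.
  by elim: w => //= x w <-; exact: Fpush.
have Fcat u v : F (u ++ v) = (F u * F v)%g.
  by elim: u => /= [|x u ->]; rewrite ?mul1g ?mulgA.
by move=> u v; rewrite /extend fwordM -!/(F _) Fred Fcat.
Qed.

HB.instance Definition _ m (t : {ffun 'I_m -> freegrp m}) :=
  isMultiplicative.Build (freegrp m) (freegrp m) (extend t)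
    (extend_multiplicative t).

Lemma extend_gen m (t : {ffun 'I_m -> freegrp m}) i :
  (extend t : endo m) (gen i) = t i.
Proof. by rewrite /= /extend /= mulg1. Qed.

Lemma images_extend m (t : {ffun 'I_m -> freegrp m}) :
  images (extend t : endo m) = t.
Proof. by apply/ffunP => i; rewrite ffunE extend_gen. Qed.

Lemma count_middle (T : Type) (a : pred T) k w : 2 * k <= size w ->
  count a w <= count a (take (size w - k - k) (drop k w)) + 2 * k.
Proof.
move=> ltk; rewrite -{1}(cat_take_drop k w) count_cat.
rewrite -{1}(cat_take_drop (size w - k - k) (drop k w)) count_cat.
rewrite drop_drop subnK; last lia.
have := count_size a (take k w); have := count_size a (drop (size w - k) w).
by rewrite size_drop size_takel; lia.
Qed.

Definition prefix_separated m k (t : 'I_m -> seq (letter m)) :=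
  [forall i, forall j, forall e, forall f, ((j, e) != (i, f)) ==>
     (take k (wsgn (t j) e) != take k (wsgn (t i) f))].

Lemma prefix_separated_in_S m l k (t : {ffun 'I_m -> freegrp m}) :
  0 < l -> prefix_separated k (fun i => fword (t i)) ->
  (forall i j, l + 2 * k <= occurrences i (fword (t j))) ->
  S_ l (extend t : endo m).
Proof.
move=> l0 sep occ.
have Hnc i : exists x r y, noncanceling (extend t : endo m) i x r y /\
    forall j, l <= occurrences j r.
  (* Since [l > 0], the occurrences of one generator already exceed [2 * k]. *)
  have ltk : 2 * k < size (t i).
    have : occurrences i (t i) <= size (t i) := count_size _ _.
    have := occ i i; lia.
  do 3!eexists; split.
    apply: (@noncanceling_middle _ _ _ k (t i)); rewrite ?extend_gen //.
    move=> j e f je; rewrite extend_gen.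
    move/forallP: sep => /(_ i)/forallP/(_ j)/forallP/(_ e)/forallP/(_ f).
    by move/implyP; apply; apply/eqP.
  move=> j; rewrite -(leq_add2r (2 * k)); apply: leq_trans (occ j i) _.
  by apply: count_middle; exact: ltnW.
split=> [i|i j].
  by have [x [r [y [nc _]]]] := Hnc i; exists x, r, y.
have [x [r [y [nc lr]]]] := Hnc j.
exact: leq_trans (lr i) (occurrences_Rem _ nc).
Qed.

(** * Counting in finite types *)

Lemma leq_card_inj_in (T T' : finType) (f : T -> T') (A : {pred T})
    (B : {pred T'}) :
  {in A, forall x, f x \in B} -> {in A &, injective f} -> #|A| <= #|B|.
Proof.
move=> fAB finj; rewrite -(card_in_image finj); apply: subset_leq_card.
by apply/fintype.subsetP => y /fintype.imageP[x Ax ->]; exact: fAB.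
Qed.

Lemma leq_card_exists (T I : finType) (P : I -> pred T) :
  #|[pred x | [exists i, P i x]]| <= \sum_i #|P i|.
Proof.
have cardE (A : pred T) : #|A| = \sum_(x : T) (x \in A).
  by rewrite -sum1_card big_mkcond.
rewrite (eq_bigr _ (fun i _ => cardE (P i))) exchange_big cardE leq_sum // => x _.
rewrite inE; case: existsP => // -[i Pi].
by rewrite (bigD1 i) //= [x \in P i]Pi.
Qed.

(** Proportions are written without division: each of the [#|I|] terms gets a share $1/(K\,|I|)$ of
    [b]. *)
Lemma muln_sum_leq (I : finType) (E : I -> nat) K b :
  (forall i, K * #|I| * E i <= b) -> K * (\sum_i E i) <= b.
Proof.
move=> KE; case: (posnP #|I|) => [I0|I0].
  by rewrite big1 ?muln0 // => i; have := fintype0 i I0.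
rewrite -(leq_pmul2l I0) mulnA (mulnC #|I|) big_distrr /=.
by apply: leq_trans (leq_sum _ (fun i _ => KE i)) _; rewrite sum_nat_const.
Qed.

(** The tuples form a product with [A] at coordinate [i] and the full type elsewhere. *)
Lemma card_coord (T : finType) m (i : 'I_m) (A : pred T) :
  #|T| * #|[pred t : {ffun 'I_m -> T} | A (t i)]|
  = #|A| * #|{ffun 'I_m -> T}|.
Proof.
pose F j := if j == i then A else predT.
have -> : #|[pred t : {ffun 'I_m -> T} | A (t i)]| = #|family F|.
  apply: eq_card => t; rewrite !inE; apply/idP/familyP => [At j|/(_ i)].
    by rewrite /F; case: eqP => // ->.
  by rewrite /F eqxx.
have prodE (G : 'I_m -> pred T) : #|family G| = \prod_j #|G j|.
  by rewrite card_family foldrE big_map big_enum.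
have -> : #|{ffun 'I_m -> T}| = \prod_(j < m) #|T|.
  by rewrite prod_nat_const card_ffun card_ord.
rewrite prodE (bigD1 i) //= [in RHS](bigD1 i) //= {1}/F eqxx.
rewrite mulnCA; congr (_ * (_ * _)); apply: eq_bigr => j ji.
by rewrite /F (negPf ji).
Qed.

Lemma card_coord_leq (T : finType) m (i : 'I_m) (A : pred T) M :
  M * #|A| <= #|T| ->
  M * #|[pred t : {ffun 'I_m -> T} | A (t i)]| <= #|{ffun 'I_m -> T}|.
Proof.
move=> MA; case: (posnP #|T|) => [T0|T0].
  rewrite [X in _ * X]eq_card0 ?muln0 // => t.
  by have := card0_eq T0 (t i).
rewrite -(leq_pmul2l T0) mulnCA card_coord mulnA.
by rewrite leq_mul2r MA orbT.
Qed.

(** * Balls of reduced words and their growth *)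

Definition wball m p := {w : p.-bseq (letter m) | reduced w}.

Definition wd m p (w : wball m p) : seq (letter m) := val (val w).

Lemma wd_inj m p : injective (@wd m p).
Proof. by move=> u v /val_inj/val_inj. Qed.

Lemma size_wd m p (w : wball m p) : size (wd w) <= p.
Proof. exact: size_bseq. Qed.

Lemma reduced_wd m p (w : wball m p) : reduced (wd w).
Proof. exact: (valP w). Qed.

(** Total, with a default value outside the ball, so that word operations become maps between finite
    types. *)
Definition mkwball m p (s : seq (letter m)) : wball m p :=
  insubd (exist _ [bseq] isT : wball m p) (insub_bseq p s).

Lemma mkwballK m p (s : seq (letter m)) :
  reduced s -> size s <= p -> wd (mkwball p s) = s.
Proof.
move=> rs sp; have vs : val (insub_bseq p s) = s :> seq _ by rewrite /= insubdK.
by rewrite /wd /mkwball [val (insubd _ _)]insubdK //= -topredE /= [bseqval _]vs.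
Qed.

(** A reduced word has two distinct reduced extensions on the left: by its own first letter once
    more, and by a different generator. *)
Lemma card_wball_double m p r : 1 < m -> r < p ->
  2 * #|[pred w : wball m p | size (wd w) <= r]|
  <= #|[pred w : wball m p | size (wd w) <= r.+1]|.
Proof.
move=> m1 rp; pose i0 : 'I_m := Ordinal (ltnW m1); pose i1 : 'I_m := Ordinal m1.
pose first (b : bool) (w : seq (letter m)) : letter m :=
  (* For the empty word, the default makes the two extensions $a_{i_0}$ and $a_{i_1}$. *)
  let y := head (i0, true) w in
  if b then y else (if y.1 == i0 then i1 else i0, true).
have redf b w : reduced w -> reduced (first b w :: w).
  case: w => //= y w; rewrite /reduced /= => ->; rewrite andbT.
  case: y => [yi ys]; rewrite /first; case: b => /=.
    by apply/eqP => -[]; case: ys.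
  by apply/eqP => -[+ _]; case: eqP => [-> /(congr1 val) //=|].
pose f (x : bool * wball m p) := mkwball p (first x.1 (wd x.2) :: wd x.2).
have -> (A : pred (wball m p)) : 2 * #|A| = #|[predX {: bool} & A]|.
  by rewrite cardX card_bool.
apply: (@leq_card_inj_in _ _ f).
  case=> b w; rewrite !inE /= => sw.
  by rewrite /f mkwballK ?redf ?reduced_wd //= (leq_ltn_trans sw).
move=> [b u] [c v]; rewrite !inE /= => su sv /(congr1 (@wd _ _)).
rewrite /f !mkwballK ?redf ?reduced_wd ?(leq_ltn_trans su) ?(leq_ltn_trans sv) //.
move=> /= [+ /wd_inj uv]; rewrite {}uv; move: (wd v) => {su sv}w.
rewrite /first; move: (head _ _) => y E; congr (_, _); move: E.
by case: b c => [] [] //; case: y => yi ys /=;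
  case: eqP => [->|h] /(congr1 fst) /= => [/(congr1 val)|] // e; case: h.
Qed.

Lemma card_wball_pow m p r k : 1 < m -> r + k <= p ->
  2 ^ k * #|[pred w : wball m p | size (wd w) <= r]|
  <= #|[pred w : wball m p | size (wd w) <= r + k]|.
Proof.
move=> m1; elim: k => [|k IHk] rkp; first by rewrite mul1n addn0.
rewrite expnS -mulnA addnS.
apply: leq_trans (card_wball_double m1 _); last by rewrite -addnS.
by rewrite leq_mul2l IHk //; apply: leq_trans rkp; rewrite addnS.
Qed.

(** * Words in which some generator is rare *)

(* Next to [u] and [v] with [u ++ v] reduced, at least one of $a_i^{\pm1}$ can
   be inserted without creating a cancellation. *)
Lemma reduced_insert m (i : 'I_m) (u v : seq (letter m)) :
  reduced (u ++ v) ->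
  exists b, reduced (u ++ (i, b) :: v).
Proof.
move=> ruv; have ru := reduced_catl ruv; have rv := reduced_catr ruv.
pose okl x := if u is a :: u' then x != linv (last a u') else true.
pose okr x := if v is b :: _ then b != linv x else true.
have ok x : okl x -> okr x -> reduced (u ++ x :: v).
  move=> lx rx; apply: (@reduced_cat_overlap _ u [:: x] v) => //.
  - move: lx ru; rewrite /okl /reduced; case: (u) => //= a u' h.
    by rewrite cats1 rcons_path h andbT.
  - by move: rx rv; rewrite /okr /reduced; case: (v) => //= b v' ->.
suff [b /andP[? ?]] : exists b, okl (i, b) && okr (i, b) by exists b; apply: ok.
move: ruv; rewrite /okl /okr /reduced; case: (u) (v) => [|a u'] [|b v'] /=.
- by exists true.
- case: b => bi bs _; exists bs; rewrite /linv /=.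
  by apply/eqP => -[_]; case: bs.
- case: (last a u') => ci cs _; exists cs; rewrite andbT /linv /=.
  by apply/eqP => -[_]; case: cs.
(* If both neighbours have the same sign, that sign works. Otherwise they belong to different
   generators: take the sign of the left neighbour if its generator is [i], else that of the right
   one. *)
- rewrite cat_path /= => /and3P[_ + _]; case: b (last a u') => bi bs [ci cs].
  rewrite /linv /= !xpair_eqE; case: bs cs => [] [] /= h.
  + by exists true; rewrite !xpair_eqE !andbF.
  + exists (i != ci); rewrite !xpair_eqE; move: h.
    by case: (eqVneq i ci) => [->|] /=; rewrite ?andbT ?andbF.
  + exists (i == ci); rewrite !xpair_eqE; move: h.
    by case: (eqVneq i ci) => [->|] /=; rewrite ?andbT ?andbF.
  + by exists false; rewrite !xpair_eqE !andbF.
Qed.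

(** A fixed rule for the sign makes insertion a function of the position and the word. *)
Definition insert m (i : 'I_m) t (w : seq (letter m)) : seq (letter m) :=
  take t w ++ (i, reduced (take t w ++ (i, true) :: drop t w)) :: drop t w.

Lemma insert_reduced m (i : 'I_m) t w : reduced w -> reduced (insert i t w).
Proof.
rewrite -{1}(cat_take_drop t w) => /(reduced_insert i)[b rb].
rewrite /insert; case E: (reduced (_ ++ (i, true) :: _)) => //.
by case: b rb => //; rewrite E.
Qed.

Lemma size_insert m (i : 'I_m) t w : size (insert i t w) = (size w).+1.
Proof. by rewrite size_cat /= addnS -size_cat cat_take_drop. Qed.

(** If one splitting came strictly later, its left part would also contain the marked letter of the
    other, and its count would be larger. *)
Lemma cat_count_inj (T : eqType) (a : pred T) u u' x x' (v v' : seq T) :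
  a x -> a x' -> u ++ x :: v = u' ++ x' :: v' -> count a u = count a u' ->
  u = u' /\ v = v'.
Proof.
move=> ax ax'; elim: u u' => [|y u IHu] [|y' u'] //=.
- by case=> _ ->.
- by case=> <- _; rewrite ax.
- by case=> -> _; rewrite ax'.
- by case=> <- /IHu{}IHu /addnI/IHu[-> ->].
Qed.

(* Inserting $a_i^{\pm1}$ at any of [s.+1] positions, then splitting off the
   first letter to get back into the ball. The position is recovered from the
   number of $a_i^{\pm1}$ before it. *)
Lemma card_rare_long m p (i : 'I_m) L s :
  s.+1 * #|[pred w : wball m p | (occurrences i (wd w) < L) && (s <= size (wd w))]|
  <= m * 2 * L.+1 * #|{: wball m p}|.
Proof.
pose A := [pred w : wball m p | (occurrences i (wd w) < L) && (s <= size (wd w))].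
pose f (x : wball m p * 'I_s.+1) : wball m p * (letter m * 'I_L.+1) :=
  let v := insert i x.2 (wd x.1) in
  (mkwball p (behead v),
   (head (i, true) v, inord (occurrences i (take x.2 (wd x.1))))).
have -> : s.+1 * #|A| = #|[predX A & {: 'I_s.+1}]|.
  by rewrite cardX card_ord mulnC.
have -> : m * 2 * L.+1 * #|{: wball m p}| = #|{: wball m p * (letter m * 'I_L.+1)}|.
  by rewrite !card_prod !card_ord card_bool mulnC.
apply: (@leq_card_inj_in _ _ f) => // -[u [t lt]] [v [t' lt']].
rewrite !inE /= !andbT => /andP[ou su] /andP[ov sv].
rewrite /f /= => -[/(congr1 (@wd _ _))].
have mk (w : wball m p) k : wd (mkwball p (behead (insert i k (wd w)))) =
    behead (insert i k (wd w)).
  apply: mkwballK; last by rewrite size_behead size_insert size_wd.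
  have := insert_reduced i k (reduced_wd w).
  by case: (insert _ _ _) => //= a l; apply: path_sorted.
rewrite !mk => eb eh eo.
have e : insert i t (wd u) = insert i t' (wd v).
  have ne k w : insert i k w <> [::] by move/(congr1 size); rewrite size_insert.
  move: eb eh (ne t (wd u)) (ne t' (wd v)).
  by case: (insert _ _ _) (insert _ _ _) => [|? ?] [|? ?] //= -> ->.
(* The count before the insertion point stays below [L.+1], so [inord] loses nothing. *)
have occ_take k (w : seq (letter m)) : occurrences i w < L ->
    occurrences i (take k w) < L.+1.
  move=> ow; rewrite ltnS (leq_trans _ (ltnW ow)) //.
  by rewrite -{2}(cat_take_drop k w) /occurrences count_cat leq_addr.
have {}eo : occurrences i (take t (wd u)) = occurrences i (take t' (wd v)).
  by have := congr1 val eo; rewrite /= !inordK ?occ_take.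
pose isi (x : letter m) := x.1 == i.
have isiE b : isi (i, b) by exact: eqxx.
have [et ed] := cat_count_inj (isiE _) (isiE _) e eo.
have euv : u = v.
  by apply: wd_inj; rewrite -(cat_take_drop t (wd u)) et ed cat_take_drop.
congr (_, _) => //; apply: val_inj => /=.
(* Positions up to [s] lie within words of length at least [s], so the length of the prefix is the
   position itself. *)
have := congr1 size et; rewrite !size_takel //.
- exact: leq_trans sv.
- exact: leq_trans su.
Qed.

(** The bound is independent of [p], whereas the ball grows without bound. *)
Lemma card_short m p s :
  #|[pred w : wball m p | size (wd w) < s]| <= #|{: s.-bseq (letter m)}|.
Proof.
apply: (@leq_card_inj_in _ _ (fun w => insub_bseq s (wd w))) => // u v.
rewrite !inE => su sv /(congr1 val) /=.
by rewrite !insubdK ?(ltnW su) ?(ltnW sv) //; [apply: wd_inj | |]; apply: ltnW.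
Qed.

Lemma card_wball_gt m p (i : 'I_m) : p < #|{: wball m p}|.
Proof.
rewrite -{1}(card_ord p.+1).
pose f (n : 'I_p.+1) := mkwball p (nseq n (i, true)).
apply: (@leq_card _ _ f) => n n' /(congr1 (@wd _ _)).
have red k : reduced (nseq k (i, true)).
  elim: k => // -[|k] //= ->; rewrite andbT.
  by apply/eqP => -[].
rewrite !mkwballK ?red ?size_nseq -1?ltnS // => /(congr1 size).
by rewrite !size_nseq => /val_inj.
Qed.

Lemma rare_negligible m (i : 'I_m) L M : exists P, forall p, P <= p ->
  M * #|[pred w : wball m p | occurrences i (wd w) < L]| <= #|{: wball m p}|.
Proof.
have m0 : 0 < m by apply: leq_ltn_trans (ltn_ord i).
(* This cutoff gives the rare words of length at least [s] a share of at most $1/(2M)$ of the ball;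
   the threshold on [p] does the same for the shorter ones. *)
pose s := 2 * M * (m * 2 * L.+1).
exists (2 * M * #|{: s.-bseq (letter m)}|) => p leP.
set A := [pred w | _]; rewrite -(leq_pmul2l (isT : 0 < 2)) mulnA.
pose B := [pred w : wball m p | size (wd w) < s].
rewrite -(cardID B A) mulnDr (mul2n #|_|) -addnn leq_add //.
  apply: leq_trans (leq_trans leP (ltnW (card_wball_gt p i))).
  rewrite leq_mul2l; apply/orP; right; apply: leq_trans (card_short m p s).
  by apply: subset_leq_card; apply/fintype.subsetP => w; rewrite !inE => /andP[].
have c0 : 0 < m * 2 * L.+1 by rewrite !muln_gt0 m0.
rewrite -(leq_pmul2l c0) mulnA (mulnC (m * 2 * L.+1)) -/s.
apply: leq_trans (card_rare_long p i L s); rewrite leq_mul //.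
apply: subset_leq_card; apply/fintype.subsetP => w.
by rewrite !inE -leqNgt andbC.
Qed.

(** * Tuples with coinciding prefixes *)

(** In rank one a reduced word repeats a single letter, so it and its inverse begin with opposite
    signs. *)
Lemma self_collision_free m k (w : seq (letter m)) :
  m = 1 -> 0 < k -> reduced w -> w <> [::] -> take k w != take k (winv w).
Proof.
move=> m1; subst m; case: k => // k _; case: w => // x w rw _.
have : all (pred1 x) w.
  elim: w x rw => //= y w IHw x /andP[yx /IHw].
  suff -> : y = x by rewrite /= eqxx.
  case: x y yx => xi xs [yi ys]; rewrite !ord1 /linv /= xpair_eqE eqxx /=.
  by case: xs ys => [] [].
move/all_pred1P; move: (size w) => n ->.
rewrite -[x :: nseq n x]/(nseq n.+1 x) /winv map_nseq.
have -> (y : letter 1) h : rev (nseq h y) = nseq h y.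
  have /all_pred1P : all (pred1 y) (rev (nseq h y)).
    by rewrite all_rev all_pred1_nseq.
  by rewrite size_rev size_nseq.
by apply/eqP => -[/(congr1 snd) /=]; case: x.2.
Qed.

(** The first [k] letters of the inverse come from the last [k] letters of [w], which survive in
    [drop k w]; the collision then returns the removed prefix. *)
Lemma collision_determined m k (w w' : seq (letter m)) :
  2 * k <= size w -> 2 * k <= size w' ->
  take k w = take k (winv w) -> take k w' = take k (winv w') ->
  drop k w = drop k w' -> w = w'.
Proof.
have E (v : seq (letter m)) : 2 * k <= size v ->
    take k (winv v) = take k (winv (drop k v)).
  move=> kv; rewrite -{1}(cat_take_drop k v) winv_cat takel_cat //.
  by rewrite size_winv size_drop; lia.
move=> kw kw'; rewrite (E w) // (E w') // => ew ew' ed.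
by rewrite -(cat_take_drop k w) -(cat_take_drop k w') ew ew' ed.
Qed.

(** The length condition keeps the two ends of a word disjoint when it collides with its own
    inverse. *)
Definition collision m p k (c : letter m * letter m)
    (t : {ffun 'I_m -> wball m p}) :=
  let: ((j, e), (i, f)) := c in
  [&& (j, e) != (i, f), [forall i, 2 * k <= size (wd (t i))]
    & take k (wsgn (wd (t j)) e) == take k (wsgn (wd (t i)) f)].

(* A colliding tuple is determined by the one obtained from it by removing the
   common prefix from the second word. *)
Lemma card_collision m p k c : k <= p ->
  #|collision k c : pred {ffun 'I_m -> wball m p}|
  <= #|[pred t : {ffun 'I_m -> wball m p} | size (wd (t c.2.1)) <= p - k]|.
Proof.
move=> kp; case: c => -[j e] [i f] /=.
pose g (t : {ffun 'I_m -> wball m p}) : {ffun 'I_m -> wball m p} :=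
  [ffun n => if n == i then mkwball p (drop k (wsgn (wd (t i)) f)) else t n].
have mk (w : wball m p) : wd (mkwball p (drop k (wsgn (wd w) f))) =
    drop k (wsgn (wd w) f).
  apply: mkwballK; last first.
    rewrite size_drop size_wsgn leq_subLR.
    by rewrite (leq_trans (size_wd w)) ?leq_addl.
  by apply: (@reduced_catr _ (take k (wsgn (wd w) f)));
    rewrite cat_take_drop reduced_wsgn reduced_wd.
apply: (@leq_card_inj_in _ _ g) => [t _|t t'].
  by rewrite inE ffunE eqxx mk size_drop size_wsgn leq_sub2r // size_wd.
rewrite !unfold_in /collision => /and3P[/eqP ji /forallP st /eqP tE].
move=> /and3P[_ /forallP st' /eqP tE'] /ffunP gE.
have tn n : n != i -> t n = t' n.
  by move=> /negPf ni; have := gE n; rewrite !ffunE ni.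
have di : drop k (wsgn (wd (t i)) f) = drop k (wsgn (wd (t' i)) f).
  by have := gE i; rewrite !ffunE eqxx => /(congr1 (@wd _ _)); rewrite !mk.
apply/ffunP => n; case: (eqVneq n i) => [->{n}|/tn //].
apply/wd_inj/(@wsgn_inj _ f).
(* For [j != i] the word at [j] is untouched and supplies the removed prefix; for [j = i] the signs
   are opposite and the word supplies it from its other end. *)
case: (eqVneq j i) => [eji|/tn tj]; last first.
  rewrite /= -(cat_take_drop k (wsgn (wd (t i)) f)) di -tE tj tE'.
  by rewrite cat_take_drop.
subst j; have ef : e = ~~ f by case: e f ji {tE tE' di mk g gE} => [] [].
move: tE tE'; rewrite ef !wsgnN => tE tE'.
by apply: (@collision_determined _ k); rewrite ?size_wsgn.
Qed.

Lemma collision_negligible m p k M (c : letter m * letter m) :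
  0 < k -> k <= p -> M <= 2 ^ k ->
  M * #|collision k c : pred {ffun 'I_m -> wball m p}|
  <= #|{ffun 'I_m -> wball m p}|.
Proof.
move=> k0 kp Mk; case: (ltnP 1 m) => m1.
  apply: leq_trans (leq_mul (leqnn M) (card_collision c kp)) _.
  apply: (@card_coord_leq _ _ c.2.1 [pred w | size (wd w) <= p - k]).
  apply: leq_trans (leq_mul Mk (leqnn _)) _.
  apply: leq_trans (card_wball_pow m1 _) _; first by rewrite subnK.
  exact: max_card.
rewrite [X in _ * X]eq_card0 ?muln0 // => t; rewrite unfold_in.
have {m1} m1 : m = 1 by apply/eqP; rewrite eqn_leq m1 (leq_trans _ (ltn_ord c.1.1)).
apply/negP; case: c => -[j e] [i f] /and3P[ji /forallP st /eqP].
have eji : j = i by subst m; rewrite !ord1.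
subst j; have -> : e = ~~ f.
  by move: ji; rewrite xpair_eqE eqxx; case: (e) (f) => [] [].
rewrite wsgnN => /esym/eqP; apply/negP; apply: self_collision_free => //.
  by rewrite reduced_wsgn reduced_wd.
move=> /(congr1 size); rewrite size_wsgn; have := st i.
by case: (wd _) => //=; lia.
Qed.

(** * Combining the two estimates *)

Definition rich m p l (t : {ffun 'I_m -> wball m p}) :=
  [forall i, forall j, l <= occurrences i (wd (t j))].

Lemma bad_negligible m l M : exists k P, forall p, P <= p ->
  M * #|[pred t : {ffun 'I_m -> wball m p} |
          ~~ (prefix_separated k (fun i => wd (t i)) && rich (l + 2 * k) t)]|
  <= #|{ffun 'I_m -> wball m p}|.
Proof.
case: (posnP m) => [m0|m0].
  subst m; exists 0, 0 => p _.
  rewrite [X in _ * X]eq_card0 ?muln0 // => t; rewrite !inE; apply/negbF/andP.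
  by split; apply/forallP => -[].
pose C := [the finType of (letter m * letter m)%type].
(* Large enough that each of the [#|C|] kinds of collision gets a share of at most $1/(2M|C|)$; the
   other half of $1/M$ is left for rare letters. *)
pose k := (2 * M * #|C|).+1; pose L := l + 2 * k.
have Mk : 2 * M * #|C| <= 2 ^ k.
  by apply: leq_trans (leqnSn _) (ltnW _); exact: ltn_expl.
pose I := [the finType of ('I_m * 'I_m)%type].
have rareP (c : I) : exists P, forall p, P <= p ->
    2 * M * #|I| * #|[pred w : wball m p | occurrences c.1 (wd w) < L]|
    <= #|{: wball m p}|.
  exact: rare_negligible.
have [P HP] := choice rareP.
exists k, (k + \max_c P c) => p leP.
have kp : k <= p by apply: leq_trans leP; apply: leq_addr.
have Pp c : P c <= p.
  by apply: leq_trans leP; apply: leq_trans (leq_addl _ _); apply: leq_bigmax.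
pose rare (c : I) :=
  [pred t : {ffun 'I_m -> wball m p} | occurrences c.1 (wd (t c.2)) < L].
pose coll (c : C) := collision k c : pred {ffun 'I_m -> wball m p}.
rewrite -(leq_pmul2l (isT : 0 < 2)) mulnA.
apply: leq_trans (_ : 2 * M * (\sum_c #|rare c| + \sum_c #|coll c|) <= _).
  rewrite leq_mul2l; apply/orP; right.
  apply: leq_trans (leq_add (leq_card_exists rare) (leq_card_exists coll)).
  rewrite -cardUI; apply: leq_trans (leq_addr _ _).
  apply: subset_leq_card; apply/fintype.subsetP => t; rewrite !inE.
  apply: contraR; rewrite negb_or => /andP[/existsPn nrare /existsPn ncoll].
  have ri : rich L t.
    apply/forallP => i; apply/forallP => j; have := nrare (i, j).
    by rewrite /= -leqNgt.
  rewrite ri andbT; apply/forallP => i; apply/forallP => j.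
  apply/forallP => e; apply/forallP => f; apply/implyP => ji.
  have := ncoll ((j, e), (i, f)); rewrite /coll /collision ji /=.
  (* Richness supplies the length condition of [collision]: every word has at least $L \ge 2k$
     letters. *)
  rewrite (_ : [forall i, _]) //; apply/forallP => n.
  move/forallP: ri => /(_ n)/forallP/(_ n) ri.
  apply: leq_trans (count_size (fun x => x.1 == n) (wd (t n))).
  by apply: leq_trans ri; apply: leq_addl.
rewrite mulnDr (mul2n #|_|) -addnn leq_add //; apply: muln_sum_leq => c.
  apply: (@card_coord_leq _ _ c.2 [pred w | occurrences c.1 (wd w) < L]).
  exact: HP.
exact: collision_negligible.
Qed.

(** * From finite counts to the density *)

Lemma card_fset_set_image (X : finType) (Y : choiceType) (f : X -> Y)
    (A : pred X) :
  injective f -> #|` fset_set (f @` [set x | A x])%classic| = #|A|.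
Proof.
move=> finj; have finA : finite_set [set x | A x]%classic by exact: finite_finset.
rewrite fset_set_image // card_imfset // cardE.
apply/perm_size/uniq_perm; rewrite ?enum_finmem_uniq ?enum_uniq // => x.
rewrite enum_finmemE mem_enum in_fset_set //.
by apply/idP/idP => [/set_mem|Ax] //; apply/mem_set.
Qed.

Definition free_tuple m p (t : {ffun 'I_m -> wball m p}) :
  {ffun 'I_m -> freegrp m} := [ffun i => FreeGrp (reduced_wd (t i))].

Lemma free_tuple_inj m p : injective (@free_tuple m p).
Proof.
move=> t t' /ffunP tt'; apply/ffunP => i; apply: wd_inj.
by have := tt' i; rewrite !ffunE => /(congr1 (@fword m)).
Qed.

Lemma ball_tuples_image m p :
  ball_tuples m p = (@free_tuple m p @` [set t | predT t])%classic.
Proof.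
apply/seteqP; split=> [t tp|_ [t _ <-] i]; last by rewrite ffunE /= size_wd.
exists [ffun i => mkwball p (fword (t i))] => //.
apply/ffunP => i; rewrite !ffunE; apply: val_inj => /=.
by rewrite mkwballK ?fword_reduced //; exact: tp.
Qed.

Lemma good_tuple_in_S m l k p (t : {ffun 'I_m -> wball m p}) :
  0 < l ->
  prefix_separated k (fun i => wd (t i)) && rich (l + 2 * k) t ->
  (images @` S_ l)%classic (free_tuple t).
Proof.
move=> l0 /andP[/forallP sep /forallP ri].
exists (extend (free_tuple t) : endo m); last exact: images_extend.
apply: (@prefix_separated_in_S _ _ k) => // [|i j].
  apply/forallP => i; apply/forallP => j; apply/forallP => e; apply/forallP => f.
  have := sep i => /forallP/(_ j)/forallP/(_ e)/forallP/(_ f).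
  by rewrite !ffunE.
by rewrite ffunE; have := ri i => /forallP/(_ j).
Qed.

Theorem theorem17 (R : realType) (m l : nat) (hm : (1 <= m)%N) (hl : (0 < l)%N) :
  has_density (S_ (m := m) l) (1%R : R).
Proof.
apply/cvgrPdist_le => eps eps0; rewrite /density_ratio.
(* With $M > 1/\varepsilon$, a share of at most $1/M$ of bad tuples is below $\varepsilon$. *)
pose M := (Num.truncn eps^-1).+1.
have [k [P bad]] := bad_negligible m l M.
apply: filterS (nbhs_infty_ge P) => p leP.
pose good (t : {ffun 'I_m -> wball m p}) :=
  prefix_separated k (fun i => wd (t i)) && rich (l + 2 * k) t.
pose B := #|[pred t | ~~ good t]|; pose T := #|{ffun 'I_m -> wball m p}|.
have MB : M * B <= T by exact: bad.
have cardB : #|` fset_set (ball_tuples m p)| = T.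
  by rewrite ball_tuples_image card_fset_set_image //; exact: free_tuple_inj.
have finS : finite_set (images @` S_ l `&` ball_tuples m p)%classic.
  by apply: (sub_finite_set _ (finite_ball_tuples m p)) => t [].
set N := #|` fset_set (images @` S_ l `&` ball_tuples m p)%classic|.
have NT : N <= T.
  rewrite -cardB; apply: fsubset_leq_card.
  rewrite -fset_set_sub //; exact: finite_ball_tuples.
(* Every tuple of the ball is bad or is counted by [N], so $1 - N/T \le B/T$. *)
have TBN : T <= B + N.
  rewrite -[T](cardC good) addnC leq_add //.
  rewrite -(card_fset_set_image good (@free_tuple_inj m p)).
  apply: fsubset_leq_card; rewrite -fset_set_sub //.
    move=> _ [t gt <-]; split; first exact: good_tuple_in_S gt.
    by rewrite ball_tuples_image; exists t.
  exact: finite_image.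
have T0 : 0 < T.
  by apply/card_gt0P; exists [ffun=> mkwball p [::]].
rewrite cardB ger0_norm; last first.
  by rewrite subr_ge0 ler_pdivrMr ?ltr0n // mul1r ler_nat.
rewrite -[X in (X - _)%R](@divff _ T%:R%R) ?pnatr_eq0 -?lt0n // -mulrBl.
rewrite ler_pdivrMr ?ltr0n // -natrB //.
have epsM : (eps^-1 <= M%:R)%R by apply/ltW; rewrite truncnS_gt.
apply: (@le_trans _ _ (B%:R)%R); first by rewrite ler_nat leq_subLR addnC.
rewrite -ler_pdivrMl // (le_trans (_ : _ <= M%:R * B%:R)%R) //.
  by rewrite ler_wpM2r.
by rewrite -natrM ler_nat.
Qed.
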